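(* For every positive integer $n$, \[\alpha(n)=\begin{cases}2n-1,& n\in\{1,2\},\\ 2n-2,& n\in\{3,4\},\\ 2n-3,& n>4.\end{cases}\]
   Context: A family $e_1,\dots,e_k$ of complex $n\times n$ matrices is called anticommuting if $e_ie_j=-e_je_i$ for all distinct $i,j\in\{1,\dots,k\}$. For a positive integer $n$, $\alpha(n)$ denotes the largest $k$ such that there exists an anticommuting family $e_1,\dots,e_k\in\mathbb{C}^{n\times n}$ with $e_1^2,\dots,e_k^2\neq 0$. *)

(* Defs.v *)
(* Complex numbers are modelled by an arbitrary numClosedFieldType
   (algebraically closed field of char. 0 with conjugation, e.g. algC). *)
From HB Require Import structures.
From mathcomp Require Import all_boot all_order all_algebra.
Set Implicit Arguments. Unset Strict Implicit. Unset Printing Implicit Defensive.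
Import GRing.Theory Num.Theory.
Local Open Scope ring_scope.

Definition anticomm_family (C : numClosedFieldType) (n k : nat)
    (e : 'I_k -> 'M[C]_n) : Prop :=
  (forall i j : 'I_k, i != j -> e i *m e j = - (e j *m e i)) /\
  (forall i : 'I_k, e i *m e i != 0).

Definition has_anticomm_family (C : numClosedFieldType) (n k : nat) : Prop :=
  exists e : 'I_k -> 'M[C]_n, anticomm_family e.

Definition is_alpha (C : numClosedFieldType) (n a : nat) : Prop :=
  has_anticomm_family C n a /\ (forall k, has_anticomm_family C n k -> (k <= a)%N).

(* Main.v *)
(* Upper bound, by strong induction on n. For generic u, v the matrix
   G_ij = u e_i e_j v has an invertible diagonal symmetric part, so k <= 2 rank G,
   and G factors through C^n. If all e_i are nilpotent, a maximal nonzero word w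
   is annihilated by every e_i on both sides, which cuts rank G down to n - 2 and
   gives k <= 2n - 4. A nontrivial idempotent commuting with the family splits
   it. If there is none, each e_i^2 (which commutes with the family) has a single
   eigenvalue, so e_i is either invertible or nilpotent. With at most one
   invertible member this gives k <= 2n - 3. With two, e_1 and e_2, every e_j
   with j > 1 swaps the two generalised eigenspaces of e_1, and the e_2 e_j with
   j > 2 restrict to an anticommuting family in dimension at most n / 2.

   Lower bound: direct sums of 1 x 1 and Pauli matrices for n <= 4; otherwise
   block matrices (0 v 0; 0 0 w; 0 0 0) together with diag(1, -1, ..., -1, 1). *)
Require Import Defs.
From mathcomp Require Import all_boot all_order all_algebra.
From mathcomp Require Import zify.
Set Implicit Arguments. Unset Strict Implicit. Unset Printing Implicit Defensive.
Import GRing.Theory Num.Theory.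
Local Open Scope ring_scope.

(** Indexing by a subset [A] of a fixed finite type lets the induction drop members by shrinking
    [A], with no renumbering. *)
Definition anticomm_on (C : fieldType) n (T : finType) (A : {set T})
    (e : T -> 'M[C]_n) : Prop :=
  {in A &, forall i j, i != j -> e i *m e j = - (e j *m e i)} /\
  {in A, forall i, e i *m e i != 0}.

Lemma anticomm_onS (C : fieldType) n (T : finType) (A B : {set T})
    (e : T -> 'M[C]_n) :
  B \subset A -> anticomm_on A e -> anticomm_on B e.
Proof.
move=> /subsetP sBA [anti sq]; split=> [i j /sBA Ai /sBA Aj|i /sBA Ai].
  exact: anti.
exact: sq.
Qed.

(** * Generic bilinear forms and rank bounds *)

Section GenericForms.
Variable C : numClosedFieldType.

(* On the moment curve x |-> (x^a)_a each form r_i is a nonzero polynomial. *)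
Lemma generic_col n (T : finType) (A : {set T}) (r : T -> 'rV[C]_n) :
  {in A, forall i, r i != 0} ->
  exists v : 'cV_n, {in A, forall i, r i *m v != 0}.
Proof.
move=> r0.
have /closed_nonrootP [x] : \prod_(i in A) rVpoly (r i) != 0.
  apply/prodf_neq0 => i /r0; apply: contraNneq => ri0.
  by rewrite -[r i]rVpolyK ri0 linear0.
rewrite /root /rVpoly horner_prod => /prodf_neq0 x0.
exists (\col_a x ^+ a) => i /x0; apply: contra_neq => /matrixP /(_ 0 0).
rewrite !mxE horner_poly => rw0; rewrite -[RHS]rw0; apply: eq_bigr => a _.
by rewrite valK mxE.
Qed.

(** Choose [v] generic for a nonzero row of each [M i], so that every [M i *m v] is nonzero, then
    [u] generic for these columns. *)
Lemma generic_bilinear m n (T : finType) (A : {set T}) (M : T -> 'M[C]_(m, n)) :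
  {in A, forall i, M i != 0} ->
  exists (u : 'rV_m) (v : 'cV_n), {in A, forall i, u *m M i *m v != 0}.
Proof.
move=> M0; pose P i := [pick a | row a (M i) != 0].
pose r i := if P i is Some a then row a (M i) else 0.
have r0 : {in A, forall i, r i != 0}.
  move=> i /M0 Mi; rewrite /r /P; case: pickP => // none.
  case/negP: Mi; apply/eqP/row_matrixP => a.
  by move/negbFE/eqP: (none a) => ->; rewrite row0.
have [v rv] := generic_col r0.
have Mv0 : {in A, forall i, (M i *m v)^T != 0}.
  move=> i Ai; have:= rv _ Ai; apply: contra_neq => Mv; rewrite /r.
  case: (P i) => [a|]; last by rewrite mul0mx.
  by rewrite -row_mul -[M i *m v]trmxK Mv trmx0 row0.
have [u Mu] := generic_col Mv0.
exists u^T, v => i /Mu; apply: contra_neq => uMv.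
by rewrite -[LHS]trmxK trmx_mul trmxK mulmxA uMv trmx0.
Qed.

(** Rank is subadditive and invariant under transposition, while the diagonal matrix has full rank
    [k]. *)
Lemma leq_double_mxrank k (G : 'M[C]_k) (d : 'rV_k) :
  G + G^T = diag_mx d -> (forall i, d 0 i != 0) -> (k <= 2 * \rank G)%N.
Proof.
move=> Gd d0; have Du : diag_mx d \in unitmx.
  by rewrite unitmxE det_diag unitfE; apply/prodf_neq0 => i _.
have:= mxrank_add G G^T; rewrite Gd (mxrank_unit Du) mxrank_tr; lia.
Qed.

(* [G i j = u e_i e_j v] for a generic functional [M |-> u M v]: its symmetric
   part is an invertible diagonal matrix, while it factors through C^n. *)
Lemma anticomm_on_factor n (T : finType) (A : {set T}) (e : T -> 'M[C]_n) :
  anticomm_on A e ->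
  exists (U : 'M_(#|A|, n)) (V : 'M_(n, #|A|)),
    [/\ (#|A| <= 2 * \rank (U *m V))%N,
        forall w : 'M_n, {in A, forall i, e i *m w = 0} -> U *m w = 0 &
        forall w : 'M_n, {in A, forall i, w *m e i = 0} -> w *m V = 0].
Proof.
case=> anti sq; have [u [v uv]] := generic_bilinear sq.
pose U := \matrix_(i < #|A|, a < n) (u *m e (enum_val i)) 0 a.
pose V := \matrix_(a < n, j < #|A|) (e (enum_val j) *m v) a 0.
have GE i j : (U *m V) i j = (u *m (e (enum_val i) *m e (enum_val j)) *m v) 0 0.
  by rewrite !mulmxA -mulmxA !mxE; apply: eq_bigr => a _; rewrite !mxE.
exists U, V; split.
- apply: (@leq_double_mxrank _ _ (\row_i (2 * (U *m V) i i))).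
    apply/matrixP => i j; rewrite [LHS]mxE [_^T i j]mxE [RHS]mxE [_ 0 i]mxE.
    case: eqVneq => [->|ij].
      by rewrite mulr1n mulr_natl mulr2n.
    rewrite mulr0n !GE anti ?enum_valP ?(inj_eq enum_val_inj) //.
    by rewrite mulmxN mulNmx mxE addNr.
  move=> i; rewrite [_ 0 i]mxE mulf_neq0 ?pnatr_eq0 // GE.
  have := uv _ (enum_valP i); apply: contra_neq => G0.
  by apply/matrixP => a b; rewrite !ord1 G0 mxE.
- move=> w ew; apply/matrixP => i a; rewrite mxE.
  have := ew _ (enum_valP i) => /(congr1 (mulmx u)) /matrixP /(_ 0 a).
  rewrite mulmxA mulmx0 !mxE => rw0; rewrite -[RHS]rw0; apply: eq_bigr => b _.
  by rewrite mxE.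
- move=> w we; apply/matrixP => a i; rewrite mxE.
  have := we _ (enum_valP i) => /(congr1 (mulmx^~ v)) /matrixP /(_ a 0).
  rewrite -mulmxA mul0mx !mxE => rw0; rewrite -[RHS]rw0; apply: eq_bigr => b _.
  by rewrite mxE.
Qed.

(* Modulo the image of [w], the factorisation lives on [ker w / im w]. *)
Lemma card_anticomm_annihilator n (T : finType) (A : {set T})
    (e : T -> 'M[C]_n) (w : 'M_n) :
  anticomm_on A e -> w != 0 -> w *m w = 0 ->
  {in A, forall i, e i *m w = 0} -> {in A, forall i, w *m e i = 0} ->
  (#|A| + 4 <= 2 * n)%N.
Proof.
move=> /anticomm_on_factor [U [V [leA Uw Vw]]] w0 ww ew we.
(* Since [M *m w = 0], the rank of [M] is at most n - rank w. The rows of [w] lie in [M] and in the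
   kernel of [V], so multiplying by [V] loses another rank w. *)
pose M := col_mx U w.
have rM : (\rank M + \rank w <= n)%N.
  by apply: mulmx0_rank_max; rewrite mul_col_mx Uw // ww col_mx0.
have := mxrank_mul_ker M V.
have : (\rank w <= \rank (M :&: kermx V))%N.
  apply: mxrankS; rewrite sub_capmx; apply/andP; split.
    by rewrite -addsmxE addsmxSr.
  by apply/sub_kermxP; apply: Vw.
have : (\rank (U *m V) <= \rank (M *m V))%N.
  by rewrite mul_col_mx mxrankS // -addsmxE addsmxSl.
have : (0 < \rank w)%N by rewrite lt0n mxrank_eq0.
lia.
Qed.
End GenericForms.

(** * Compression to the image of a commuting idempotent *)

Lemma anticomm_on_restrict (C : fieldType) n (T : finType) (A : {set T})
    (e : T -> 'M[C]_n) (E : 'M_n) :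
  {in A &, forall i j, i != j -> e i *m e j = - (e j *m e i)} ->
  E *m E = E -> {in A, forall i, E *m e i = e i *m E} ->
  {in A, forall i, E *m (e i *m e i) != 0} ->
  exists e' : T -> 'M[C]_(\rank E), anticomm_on A e'.
Proof.
move=> anti EE Ee sq; pose R := row_base E; pose L := col_base E.
have LR : L *m R = E by exact: mulmx_base.
have RL : R *m L = 1%:M.
  apply: (row_full_inj (col_base_full E)); apply: (row_free_inj (row_base_free E)).
  by rewrite -/R -/L mulmx1 mulmxA LR -mulmxA LR EE.
have RE : R *m E = R.
  by transitivity (R *m (L *m R)); [rewrite LR | rewrite mulmxA RL mul1mx].
(* Compression is multiplicative here: the inner [L *m R] is [E], which moves past [e i] and is
   absorbed by [R]. *)
have e'M i j : i \in A ->
    (R *m e i *m L) *m (R *m e j *m L) = R *m (e i *m e j) *m L.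
  move=> Ai; transitivity (R *m (e i *m (L *m R) *m e j) *m L).
    by rewrite !mulmxA.
  by rewrite LR -Ee // !mulmxA RE.
exists (fun i => R *m e i *m L); split=> [i j Ai Aj ij|i Ai].
  by rewrite !e'M // anti // mulmxN mulNmx.
rewrite e'M //; have := sq i Ai; apply: contra_neq => z.
transitivity ((L *m R) *m (e i *m e i) *m (L *m R)).
  by rewrite LR -!mulmxA -(Ee i) // (mulmxA (e i)) -(Ee i) // !mulmxA !EE.
by rewrite mulmxA -(mulmxA L) -(mulmxA L) z mulmx0 mul0mx.
Qed.

(** * Anticommuting nilpotent families *)

Section Nilpotent.
Variables (C : fieldType) (n : nat) (T : finType) (A : {set T}).
Variable e : T -> 'M[C]_n.+1.
Hypothesis anti : {in A &, forall i j, i != j -> e i * e j = - (e j * e i)}.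
Hypothesis nil : {in A, forall i, exists m, e i ^+ m = 0}.

(* [w] is a longest nonzero word of the form e_1^a_1 ... e_r^a_r. *)
Lemma nilpotent_anticomm_word (s : seq T) :
  {subset s <= A} ->
  exists w : 'M_n.+1,
    [/\ w != 0,
        {in A, forall j, e j * w = w * e j \/ e j * w = - (w * e j)},
        {in s, forall j, e j * w = 0} &
        w = 1 \/ forall x, {in A, forall j, x * e j = 0} -> x * w = 0].
Proof.
elim: s => [|i s IHs] sA.
  exists 1; split; rewrite ?oner_neq0 //; last by left.
  by move=> j _; left; rewrite mulr1 mul1r.
have Ai : i \in A by apply: sA; rewrite mem_head.
have [|w [w0 cw sw w1]] := IHs; first by move=> j js; apply: sA; rewrite inE js orbT.
have exm : exists m, e i ^+ m * w == 0.
  by have [m em] := nil Ai; exists m; rewrite em mul0r.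
(* The least exponent killing [w] is [a.+1], so [e i ^+ a * w] is nonzero but killed by [e i]. If
   [a] is 0 the word is unchanged, hence the alternative [w = 1] in the statement. *)
case: (ex_minnP exm) => [[|a]]; first by rewrite mul1r (negPf w0).
move=> /eqP eaw amin.
have cX j a' : j \in A ->
    e j * e i ^+ a' = e i ^+ a' * e j \/ e j * e i ^+ a' = - (e i ^+ a' * e j).
  move=> Aj; case: (eqVneq j i) => [->|ji]; first by left; rewrite -exprS -exprSr.
  elim: a' => [|a' IH]; first by left; rewrite expr0 mulr1 mul1r.
  rewrite exprS mulrA anti // mulNr -!mulrA.
  by case: IH => ->; [right|left]; rewrite ?mulrN ?opprK.
exists (e i ^+ a * w); split.
- by apply/negP => /amin; rewrite ltnn.
- move=> j Aj; rewrite mulrA.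
  by case: (cX j a Aj) => ->; case: (cw j Aj) => cwj;
    rewrite ?mulNr -!mulrA cwj ?mulrN ?opprK; auto.
- move=> j; rewrite inE => /predU1P [->|js]; first by rewrite mulrA -exprS.
  have Aj : j \in A by apply: sA; rewrite inE js orbT.
  by rewrite mulrA; case: (cX j a Aj) => ->;
    rewrite ?mulNr -!mulrA (sw _ js) mulr0 ?oppr0.
- case: a {eaw amin} => [|a]; first by rewrite expr0 mul1r.
  by right=> x xe; rewrite exprS !mulrA xe // !mul0r.
Qed.

(** The maximal word is killed on the left, and on the right because it commutes with each [e i] up
    to sign. It is not the empty word, as some [e i] is nonzero, so being killed on the right by
    every letter it also satisfies [w * w = 0]. *)
Lemma nilpotent_anticomm_annihilator :
  A != set0 -> {in A, forall i, e i != 0} ->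
  exists w : 'M_n.+1, [/\ w != 0, w * w = 0,
    {in A, forall i, e i * w = 0} & {in A, forall i, w * e i = 0}].
Proof.
case/set0Pn => i Ai e0.
have [|w [w0 cw sw w1]] := @nilpotent_anticomm_word (enum A).
  by move=> j; rewrite mem_enum.
have ew : {in A, forall i, e i * w = 0} by move=> j Aj; rewrite sw ?mem_enum.
have we : {in A, forall i, w * e i = 0}.
  move=> j Aj; have := ew j Aj; case: (cw j Aj) => -> // /eqP.
  by rewrite oppr_eq0 => /eqP.
exists w; split=> //; case: w1 => [w1|]; last exact.
by case/eqP: (e0 i Ai); have := ew i Ai; rewrite w1 mulr1.
Qed.
End Nilpotent.

(** * Idempotents as polynomials in a matrix *)

Section Spectral.
Variables (C : fieldType) (n : nat).
Implicit Types (a b : 'M[C]_n.+1) (p q : {poly C}).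

Lemma horner_mx_Bezout a p q u v :
  u * p + v * q = 1 -> 1 - horner_mx a (v * q) = horner_mx a (u * p).
Proof. by move=> uv; rewrite -(rmorph1 (horner_mx a)) -rmorphB -uv addrK. Qed.

Lemma horner_mx_idempotent a p q u v :
  u * p + v * q = 1 -> horner_mx a (p * q) = 0 ->
  horner_mx a (v * q) * horner_mx a (v * q) = horner_mx a (v * q).
Proof.
move=> uv pq; apply/eqP; rewrite -subr_eq0 -{3}[horner_mx a _]mulr1 -mulrBr.
rewrite -opprB mulrN oppr_eq0 (horner_mx_Bezout a uv) -rmorphM.
by rewrite [v * q * _]mulrC mulrACA rmorphM /= pq mulr0.
Qed.

(** Fitting decomposition: [E] projects onto the generalised kernel of [a]. It is a polynomial in
    [a], so it commutes with whatever commutes with [a]. *)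
Lemma nilpotent_or_idempotent a :
  a \isn't a GRing.unit ->
  (exists m, a ^+ m = 0) \/
  exists E, [/\ E * E = E, E != 0, E != 1 & forall b, b * a = a * b -> E * b = b * E].
Proof.
move=> aN.
have [m [q q0 aq]] := multiplicity_XsubC (char_poly a) 0.
rewrite monic_neq0 ?char_poly_monic //= in q0.
rewrite polyC0 subr0 in aq.
(* One factor ['X] beyond the multiplicity [m] makes 1 - E a visible multiple of [a], giving an
   explicit inverse when [E] is 0. *)
have cpq : coprimep 'X^(m.+1) q.
  by rewrite coprimep_expl // coprimep_sym -['X]subr0 -polyC0 coprimep_XsubC.
have apq : horner_mx a ('X^(m.+1) * q) = 0.
  by rewrite exprS -mulrA [_ * q]mulrC -aq rmorphM /= Cayley_Hamilton mulr0.
have aX k : horner_mx a 'X^k = a ^+ k by rewrite rmorphXn /= horner_mx_X.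
have /Bezout_eq1_coprimepP [[u v] /= uv] := cpq.
have EE := horner_mx_idempotent uv apq; have E' := horner_mx_Bezout a uv.
set E := horner_mx a (v * q) in E' EE.
have [E0|E0] := eqVneq E 0.
  case/negP: aN; rewrite E0 subr0 in E'.
  apply/unitrP; exists (horner_mx a (u * 'X^m)).
  rewrite -{2 3}[a]expr1 -aX -!rmorphM /= [X in _ /\ horner_mx a X = _]mulrC.
  by rewrite -!mulrA -exprD addn1 -E'.
have [E1|E1] := eqVneq E 1.
  left; exists m.+1.
  by rewrite -[LHS]mulr1 -E1 -aX -rmorphM /= mulrCA rmorphM /= apq mulr0.
right; exists E; split=> // b ab.
by apply: comm_horner_mx; rewrite /comm_mx -mulmxE in ab *.
Qed.
End Spectral.

Lemma anticomm_horner_mx (C : comNzRingType) n (a b : 'M[C]_n.+1) (r : {poly C}) :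
  b * a = - (a * b) -> b * horner_mx a r = horner_mx (- a) r * b.
Proof.
move=> ba; elim/poly_ind: r => [|r c IH]; first by rewrite !rmorph0 mulr0 mul0r.
rewrite !rmorphD !rmorphM /= !horner_mx_X !horner_mx_C mulrDr mulrDl mulrA IH.
by rewrite -!mulrA ba mulNr -!mulmxE scalar_mxC.
Qed.

(* [E] is the projection onto the generalised [mu]-eigenspace of [a] along the
   one for [- mu]; anything anticommuting with [a] swaps the two. *)
Lemma half_idempotent (C : numClosedFieldType) n (a : 'M[C]_n.+1) (mu : C) m :
  mu != 0 -> (a * a - (mu ^+ 2)%:M) ^+ m = 0 ->
  exists E : 'M_n.+1, E * E = E /\
    forall b, b * a = - (a * b) -> b * E = (1 - E) * b.
Proof.
move=> mu0 am.
pose p := ('X - mu%:P) ^+ m; pose q := ('X - (- mu)%:P) ^+ m.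
pose P := (a - mu%:M) ^+ m; pose Q := (a + mu%:M) ^+ m.
have cmu : GRing.comm (a - mu%:M) (a + mu%:M).
  apply: commrD; last by apply: comm_mx_scalar.
  by apply: commr_sym; apply: commrB => //; apply: comm_mx_scalar.
have PQ : P * Q = 0.
  rewrite -exprMn_comm // -am; congr (_ ^+ m).
  have amu : a * mu%:M = mu%:M * a by apply: scalar_mxC.
  by rewrite mulrBl !mulrDr amu opprD addrA addrK expr2 scalar_mxM mulmxE.
have QP : Q * P = 0.
  by rewrite -PQ; apply: commrX; apply: commr_sym; apply: commrX.
have pa : horner_mx a p = P.
  by rewrite rmorphXn rmorphB /= horner_mx_X horner_mx_C.
have qa : horner_mx a q = Q.
  by rewrite rmorphXn rmorphB /= horner_mx_X horner_mx_C raddfN opprK.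
have pNa : horner_mx (- a) p = (-1) ^+ m * Q.
  by rewrite rmorphXn rmorphB /= horner_mx_X horner_mx_C -opprD -exprNn.
have qNa : horner_mx (- a) q = (-1) ^+ m * P.
  by rewrite rmorphXn rmorphB /= horner_mx_X horner_mx_C raddfN -opprD -exprNn.
have cpq : coprimep p q.
  rewrite coprimep_expl // coprimep_expr // coprimep_XsubC2 //.
  by rewrite -opprD oppr_eq0 -mulr2n mulrn_eq0.
have pq0 : horner_mx a (p * q) = 0 by rewrite rmorphM /= pa qa.
have /Bezout_eq1_coprimepP [[u v] /= uv] := cpq.
(* Replacing [a] by [- a] exchanges [P] and [Q] up to sign, so E F and (1 - E)(1 - F) both vanish,
   which forces F = 1 - E. *)
pose E := horner_mx a (v * q); pose F := horner_mx (- a) (v * q).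
have QsP : Q * ((-1) ^+ m * P) = 0 by rewrite mulrA commr_sign -mulrA QP mulr0.
have PsQ : P * ((-1) ^+ m * Q) = 0 by rewrite mulrA commr_sign -mulrA PQ mulr0.
have EF : E * F = 0.
  rewrite /E /F [v * q in X in _ * X]mulrC !rmorphM /= qa qNa.
  by rewrite mulrA -[_ * Q * _]mulrA QsP mulr0 mul0r.
have EF' : (1 - E) * (1 - F) = 0.
  rewrite !(horner_mx_Bezout _ uv) [u * p in X in _ * X]mulrC !rmorphM /= pa pNa.
  by rewrite mulrA -[_ * P * _]mulrA PsQ mulr0 mul0r.
have E'F : 1 - E = F.
  by apply: subr0_eq; rewrite -EF' mulrBr mulr1 mulrBl EF mul1r subr0.
exists E; split=> [|b ba]; first exact: horner_mx_idempotent uv pq0.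
by rewrite E'F; apply: anticomm_horner_mx.
Qed.

(** * Arithmetic of the bound *)

Definition alpha_val n : nat :=
  if (n <= 2)%N then (2 * n - 1)%N
  else if (n <= 4)%N then (2 * n - 2)%N else (2 * n - 3)%N.

Lemma leq_alpha_valD p q n :
  (p + q <= n)%N -> (alpha_val p + alpha_val q <= alpha_val n)%N.
Proof. by rewrite /alpha_val; do !case: ifP; lia. Qed.

(** The 2 pays for two invertible members, and [r] is the dimension of one of the two swapped
    halves. *)
Lemma leq_alpha_val_double r n :
  (0 < r)%N -> (r + r <= n)%N -> (2 + alpha_val r <= alpha_val n)%N.
Proof. by rewrite /alpha_val; do !case: ifP; lia. Qed.

(** * Upper bound *)

Section UpperBound.
Variables (C : numClosedFieldType) (T : finType).

Lemma card_anticomm_two_units n (A : {set T}) (e : T -> 'M[C]_n.+1) i1 i2 :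
  (forall m, (m < n.+1)%N -> forall (A : {set T}) (e : T -> 'M[C]_m),
     anticomm_on A e -> (#|A| <= alpha_val m)%N) ->
  anticomm_on A e -> i1 \in A -> i2 \in A -> i1 != i2 ->
  e i1 \is a GRing.unit -> e i2 \is a GRing.unit ->
  (exists2 mu, mu != 0 & exists m, (e i1 * e i1 - (mu ^+ 2)%:M) ^+ m = 0) ->
  (#|A| <= alpha_val n.+1)%N.
Proof.
move=> IH [anti sq] A1 A2 i12 u1 u2 [mu mu0 [m am]].
have [E [EE swap]] := half_idempotent mu0 am.
set a := e i1 in u1 am swap *; set b := e i2 in u2.
have bE : b * E = (1 - E) * b.
  by apply: swap; apply: anti => //; rewrite eq_sym.
have bE' : b * (1 - E) = E * b.
  by rewrite mulrBr mulr1 bE mulrBl mul1r opprB addrC subrK.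
have E0 : E != 0.
  apply/eqP => E0; move: bE u2; rewrite E0 mulr0 subr0 mul1r => <-.
  by rewrite unitr0.
(* The invertible [b] conjugates [E] into [1 - E]. *)
have rE : \rank (1 - E)%R = \rank E.
  rewrite -(mxrankMfree (1 - E) (_ : row_free b)) ?row_free_unit //.
  by rewrite mulmxE -bE -mulmxE (eqmxMfull _ (_ : row_full b)) ?row_full_unit.
have rEE : (\rank E + \rank (1 - E)%R <= n.+1)%N.
  by apply: mulmx0_rank_max; rewrite mulmxE mulrBr mulr1 EE subrr.
have rE0 : (0 < \rank E)%N by rewrite lt0n mxrank_eq0.
pose D := A :\ i1 :\ i2.
have DA j : j \in D -> [/\ j != i1, j != i2 & j \in A].
  by rewrite !inE => /and3P [].
have bX j : j \in D -> b * e j = - (e j * b).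
  by case/DA => j1 j2 Aj; apply: anti; rewrite // eq_sym.
(* Up to the factor [- (b * b)], products of the [b * e i] are products of the [e i], so
   anticommutation carries over. *)
have fM i j : i \in D -> b * e i * (b * e j) = - (b * b) * (e i * e j).
  move=> Di; rewrite !mulrA -[b * e i * b]mulrA -[e i * b]opprK -bX //.
  by rewrite mulrN !mulNr !mulrA.
have [|||i Di|e' /IH] := @anticomm_on_restrict C _ T D (fun j => b * e j) E.
- move=> i j Di Dj ij; rewrite !mulmxE !fM //.
  have [[_ _ Ai] [_ _ Aj]] := (DA _ Di, DA _ Dj).
  by have := anti i j Ai Aj ij; rewrite !mulmxE => ->; rewrite mulrN.
- exact: EE.
- move=> j Dj; have [j1 _ Aj] := DA _ Dj.
  have ejE : e j * E = (1 - E) * e j by apply: swap; apply: anti.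
  by rewrite !mulmxE -(mulrA b) ejE !mulrA bE'.
(* If [E] killed the square of [e i], conjugating by [b] would show that [1 - E] kills it too, so it
   would be zero. *)
- have [i1' _ Ai] := DA _ Di; rewrite !mulmxE fM //.
  have bs : b * (e i * e i) = e i * e i * b.
    by rewrite mulrA bX // mulNr -[e i * b * _]mulrA bX // mulrN opprK mulrA.
  have := sq i Ai; apply: contra_neq; rewrite mulmxE => z.
  have Es : E * (e i * e i) = 0.
    apply: (mulIr u2); apply: (mulIr u2); rewrite !mul0r.
    transitivity (E * (b * b * (e i * e i))).
      by rewrite -[b * b * _]mulrA bs [b * (_ * b)]mulrA bs !mulrA.
    by apply: oppr_inj; rewrite oppr0 -[RHS]z mulNr mulrN.
  have E's : (1 - E) * (e i * e i) = 0.
    by apply: (mulIr u2); rewrite mul0r -[LHS]mulrA -bs [LHS]mulrA -bE -[LHS]mulrA Es mulr0.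
  by move: E's; rewrite mulrBl Es subr0 mul1r.
have -> : #|A| = (2 + #|D|)%N.
  by rewrite (cardsD1 i1) A1 (cardsD1 i2 (A :\ i1)) !inE eq_sym i12 A2.
move=> leD; apply: leq_trans (leq_alpha_val_double rE0 _); last by rewrite -{2}rE.
rewrite leq_add2l; apply: leD; lia.
Qed.

Lemma eigenvalue_exists n (a : 'M[C]_n.+1) :
  exists lam, a - lam%:M \isn't a GRing.unit.
Proof.
have /closed_rootP [lam] : size (char_poly a) != 1 by rewrite size_char_poly.
rewrite -eigenvalue_root_char /eigenvalue /eigenspace kermx_eq0 row_free_unit.
by exists lam.
Qed.

Lemma card_anticomm_on n (A : {set T}) (e : T -> 'M[C]_n) :
  anticomm_on A e -> (#|A| <= alpha_val n)%N.
Proof.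
elim/ltn_ind: n A e => -[|n] IH A e [anti sq].
  case: (set_0Vmem A) => [->|[i /sq]]; first by rewrite cards0.
  by rewrite flatmx0 eqxx.
have aA := conj anti sq : anticomm_on A e.
have sqC i j : i \in A -> j \in A -> e j * (e i * e i) = e i * e i * e j.
  move=> Ai Aj; case: (eqVneq i j) => [->|ij]; first by rewrite mulrA.
  have := anti j i Aj Ai; rewrite eq_sym => /(_ ij); rewrite !mulmxE => ji.
  by rewrite mulrA ji mulNr -[e i * e j * _]mulrA ji mulrN opprK mulrA.
have split (E : 'M_n.+1) : E * E = E -> E != 0 -> E != 1 ->
    {in A, forall i, E * e i = e i * E} -> (#|A| <= alpha_val n.+1)%N.
  move=> EE E0 E1 Ee.
  have rEE : (\rank E + \rank (1 - E)%R <= n.+1)%N.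
    by apply: mulmx0_rank_max; rewrite mulmxE mulrBr mulr1 EE subrr.
  have rE : (0 < \rank E)%N by rewrite lt0n mxrank_eq0.
  have rE' : (0 < \rank (1 - E)%R)%N by rewrite lt0n mxrank_eq0 subr_eq0 eq_sym.
  have part (F : 'M_n.+1) : F * F = F -> (\rank F < n.+1)%N ->
      {in A, forall i, F * e i = e i * F} ->
      (#|[set i in A | (F * (e i * e i) != 0)%R]| <= alpha_val (\rank F))%N.
    move=> FF rF Fe; pose AF := [set i in A | F * (e i * e i) != 0].
    have AFA : {subset AF <= A} by move=> i; rewrite inE => /andP [].
    have [| | |i|e'] := @anticomm_on_restrict C _ T AF e F.
    - by move=> i j /AFA Ai /AFA Aj; apply: anti.
    - exact: FF.
    - by move=> i /AFA; apply: Fe.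
    - by rewrite inE => /andP [].
    exact: IH.
  apply: leq_trans (leq_alpha_valD rEE).
  apply: leq_trans (leq_add (part E EE _ Ee) (part (1 - E)%R _ _ _)); try lia.
  (* A square killed by both [E] and [1 - E] is zero, so each index survives in at least one
     summand. *)
  - apply: leq_trans (leq_card_setU _ _); apply: subset_leq_card.
    apply/subsetP => i Ai; rewrite !inE Ai -negb_and; apply: contraNN (sq i Ai).
    case/andP => /eqP z; rewrite mulrBl mul1r z subr0; exact.
  - by rewrite mulrBr mulr1 mulrBl mul1r EE subrr subr0.
  - by move=> i Ai; rewrite mulrBr mulrBl mulr1 mul1r Ee.
(* With the bound assumed false, [split] excludes nontrivial commuting idempotents, so every
   non-unit commuting with the family is nilpotent. *)
apply: contraT => ngoal.
have nilp (a : 'M_n.+1) : a \isn't a GRing.unit ->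
    {in A, forall i, e i * a = a * e i} -> exists m, a ^+ m = 0.
  move=> /nilpotent_or_idempotent [//|[E [EE E0 E1 EX]]] ea.
  by case/negP: ngoal; apply: (split E) => // i /ea; apply: EX.
pose B := [set i in A | e i \is a GRing.unit].
have BA i : i \in B -> i \in A /\ e i \is a GRing.unit.
  by rewrite inE => /andP.
have [B2|B1] := ltnP 1 #|B|.
  have /card_gt1P [i1 [i2 [/BA [A1 u1] /BA [A2 u2] i12]]] := B2.
  case/negP: ngoal; apply: (card_anticomm_two_units IH aA A1 A2 i12 u1 u2).
  have [lam lamP] := eigenvalue_exists (e i1 * e i1).
  have lam0 : lam != 0.
    by apply: contraNneq lamP => ->; rewrite raddf0 subr0 unitrM_comm ?u1.
  exists (sqrtC lam); first by rewrite sqrtC_eq0.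
  rewrite sqrtCK; apply: nilp => // j Aj.
  by rewrite mulrBr mulrBl sqC // -[lam%:M * _]scalar_mxC.
have cA : (#|A| <= 1 + #|A :\: B|)%N.
  by rewrite -(cardsID B) leq_add2r (leq_trans _ B1) // subset_leq_card ?subsetIr.
case/negP: ngoal; have [D0|D0] := eqVneq (A :\: B) set0.
  by move: cA; rewrite D0 cards0 /alpha_val; do !case: ifP; lia.
have DA : {subset A :\: B <= A} by move=> i; rewrite inE => /andP [].
have [||i|w [w0 ww ew we]] := @nilpotent_anticomm_annihilator C n T (A :\: B) e _ _ D0.
- by move=> i j /DA Ai /DA Aj; apply: anti.
- move=> i Di; have Ai := DA i Di.
  (* The square of a non-unit member commutes with the whole family, hence is nilpotent. *)
  have [|j Aj|m em] := nilp (e i * e i); last 1 first.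
  + by exists (m + m)%N; rewrite exprD -exprMn_comm.
  + move: Di; rewrite !inE Ai andbT -expr2 unitrX_pos //.
  + exact: sqC.
- by move=> /DA /sq; apply: contra_neq => ->; rewrite mul0mx.
have aD := anticomm_onS (subsetDl A B) aA.
have := card_anticomm_annihilator aD w0 ww ew we.
by move: cA; rewrite /alpha_val; do !case: ifP; lia.
Qed.
End UpperBound.

(** * Explicit families *)

Section LowerBound.
Variable C : numClosedFieldType.

Lemma has_anticomm_family_fin n (T : finType) (e : T -> 'M[C]_n) :
  anticomm_on setT e -> has_anticomm_family C n #|T|.
Proof.
case=> anti sq; exists (fun i => e (enum_val i)); split=> [i j ij|i].
  by apply: anti; rewrite ?inE // (inj_eq enum_val_inj).
by apply: sq; rewrite inE.
Qed.

(** Members from different diagonal blocks have product zero in both orders, so they anticommute. *)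
Lemma has_anticomm_familyD m n k l :
  has_anticomm_family C m k -> has_anticomm_family C n l ->
  has_anticomm_family C (m + n) (k + l).
Proof.
move=> [e [eA esq]] [f [fA fsq]].
have -> : (k + l = #|{: 'I_k + 'I_l}|)%N by rewrite card_sum !card_ord.
apply: (@has_anticomm_family_fin _ _ (fun x => match x with
  | inl i => block_mx (e i) 0 0 0 | inr j => block_mx 0 0 0 (f j) end)).
split=> [[i|i] [j|j] _ _ ij|[i|i] _];
  rewrite mulmx_block ?mulmx_block ?(mul0mx, mulmx0) ?(addr0, add0r).
- by rewrite eA // opp_block_mx !oppr0.
- by rewrite opp_block_mx !oppr0.
- by rewrite opp_block_mx !oppr0.
- by rewrite fA // opp_block_mx !oppr0.
- by apply: contra_neq (esq i); rewrite -block_mx0 => /eq_block_mx [].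
- by apply: contra_neq (fsq i); rewrite -block_mx0 => /eq_block_mx [].
Qed.

Lemma has_anticomm_family1 : has_anticomm_family C 1 1.
Proof.
exists (fun=> 1%:M); split=> [i j|_]; first by rewrite !ord1.
by rewrite mul1mx oner_neq0.
Qed.

Lemma has_anticomm_family2 : has_anticomm_family C 2 3.
Proof.
have -> : 3%N = #|{: option bool}| by rewrite card_option card_bool.
apply: (@has_anticomm_family_fin (1 + 1) _ (fun x : option bool =>
  if x is Some b then block_mx 0 1%:M ((-1) ^+ b)%:M 0
  else block_mx 1%:M 0 0 (- 1%:M))).
have n1 : (1%:M : 'M[C]_1) != 0 by rewrite oner_neq0.
have N1 : (-1)%:M = - 1%:M :> 'M[C]_1 by rewrite raddfN.
split=> [x y _ _|x _].
  case: x y => [[]|] [[]|] //= _; rewrite !mulmx_block opp_block_mx;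
  by rewrite ?(mul0mx, mulmx0, mul1mx, mulmx1, addr0, add0r, expr0, expr1)
     ?(N1, mulmxN, mulNmx, mulmx1, mul1mx, opprK, oppr0).
apply: contra_neq n1; case: x => [[]|];
  rewrite !mulmx_block -[0 in RHS]block_mx0 => /eq_block_mx [+ _ _ _];
  rewrite ?(mul0mx, mulmx0, mul1mx, mulmx1, addr0, add0r, expr0, expr1) // N1.
by move=> /eqP; rewrite oppr_eq0 => /eqP.
Qed.

(* The symmetric form v w' + v' w on pairs (v, w) has the orthogonal basis
   (x_i, +- x_i), which gives 2d matrices with square +-1 in the corner. *)
Lemma has_anticomm_family_corner d :
  has_anticomm_family C (1 + (d + 1)) (2 * d).+1.
Proof.
have -> : (2 * d).+1 = #|{: option ('I_d * bool)}|.
  by rewrite card_option card_prod card_ord card_bool mulnC.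
pose e (x : option ('I_d * bool)) : 'M[C]_(1 + (d + 1)) :=
  if x is Some (i, b)
  then block_mx 0 (row_mx (delta_mx 0 i) 0)
                0 (block_mx 0 ((-1) ^+ b *: delta_mx i 0) 0 0)
  else block_mx 1%:M 0 0 (block_mx (- 1%:M) 0 0 1%:M).
have eS i b j c : e (Some (i, b)) *m e (Some (j, c)) =
    block_mx 0 (row_mx 0 ((-1) ^+ c *: ((i == j)%:R%:M))) 0 0.
  rewrite /e mulmx_block !(mul0mx, mulmx0, addr0, add0r) mul_row_block mulmx_block.
  rewrite !(mul0mx, mulmx0, addr0, add0r) -!scalemxAr block_mx0.
  by rewrite mul_delta_mx_cond; congr block_mx; congr row_mx; congr (_ *: _);
     apply/matrixP => x y; rewrite !ord1 mulmxnE !mxE eqxx.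
have eN : e None *m e None = 1%:M.
  rewrite /e !mulmx_block !(mul0mx, mulmx0, addr0, add0r, mulmx1).
  by rewrite mulNmx mulmxN opprK mulmx1 -!scalar_mx_block.
(* The nonzero entries of [e (Some _)] link an outer coordinate to a middle one, where the diagonal
   [e None] has opposite signs. *)
have eSN i b : e (Some (i, b)) *m e None = - (e None *m e (Some (i, b))).
  rewrite /e !mulmx_block !mul_row_block !mul_mx_row.
  rewrite !(mul0mx, mulmx0, mul1mx, mulmx1, addr0, add0r, row_mx0).
  by rewrite !opp_block_mx opp_row_mx mulmxN mulNmx mulmx1 mul1mx opprK !oppr0.
apply: (@has_anticomm_family_fin _ _ e); split.
  case=> [[i b]|] [[j c]|] // _ _ ij.
  - rewrite !eS opp_block_mx !oppr0 opp_row_mx oppr0 eq_sym.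
    congr (block_mx _ (row_mx _ _) _ _).
    have [ji|] := eqVneq j i; last by rewrite raddf0 !scaler0 oppr0.
    move: ij; rewrite ji; case: b c => [] [] //; rewrite ?eqxx // => _.
    + by rewrite expr0 expr1 scaleNr opprK.
    + by rewrite expr0 expr1 scaleNr.
  - by rewrite eSN opprK.
case=> [[i b]|] _; last by rewrite eN; exact: oner_neq0.
rewrite eS eqxx -[X in _ != X]block_mx0; apply/eqP => /eq_block_mx [_ + _ _].
rewrite -[RHS]row_mx0 => /eq_row_mx [_ /matrixP /(_ 0 0)].
by rewrite !mxE eqxx mulr1 => /eqP; rewrite signr_eq0.
Qed.

Lemma has_anticomm_family_alpha_val n :
  (0 < n)%N -> has_anticomm_family C n (alpha_val n).
Proof.
case: n => [//|[|[|[|[|n]]]]] _.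
- exact: has_anticomm_family1.
- exact: has_anticomm_family2.
- exact: has_anticomm_familyD has_anticomm_family2 has_anticomm_family1.
- exact: has_anticomm_familyD has_anticomm_family2 has_anticomm_family2.
(* The dimension is now n + 5, and the corner construction needs [d] equal to the dimension minus
   2. *)
have := has_anticomm_family_corner n.+3.
rewrite addn1 add1n (_ : (2 * n.+3).+1 = alpha_val n.+4.+1) //.
by rewrite /alpha_val /=; lia.
Qed.
End LowerBound.

Theorem theorem5p2 (C : numClosedFieldType) (n : nat) :
  (0 < n)%N ->
  is_alpha C n (if (n <= 2)%N then (2 * n - 1)%N
                else if (n <= 4)%N then (2 * n - 2)%N
                else (2 * n - 3)%N).
Proof.
move=> n0; split=> [|k [e [anti sq]]]; first exact: has_anticomm_family_alpha_val.
rewrite -[k]card_ord -cardsT; apply: (@card_anticomm_on C _ n _ e).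
by split=> [i j _ _|i _]; [apply: anti | apply: sq].
Qed.
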